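(* For every polynomial-time computable function $f$ there exists an orthogonal predicative recursive TRS $\mathcal{R}_f$ that computes $f$.
   Context: A TRS computes a function $f$ if for some defined symbol $g$ the relation $[\![g]\!]$ coincides with (the graph of) $f$, inputs and outputs being represented as values (natural numbers in binary notation, built from a constant $\epsilon$ and unary constructors $\mathsf{S}_1,\mathsf{S}_2$); $[\![g]\!]$ consists of tuples $(v_1,\dots,v_n,w)$ of values such that $g(v_1,\dots,v_n)$ innermost-rewrites to the normal form $w$. Orthogonal: left-linear and non-overlapping. Signature split into defined symbols $\mathcal{D}$ and constructors; values are terms over constructors and variables; basic terms $g(v_1,\dots,v_n)$, $g\in\mathcal{D}$, $v_i$ values; constructor TRS: finite, left-hand sides basic. Safe mapping: safe positions per symbol, others normal, constructors all safe; notation $f(s_1..s_k;s_{k+1}..s_{k+l})$. Precedence $\succeq$ ($\succ,\sim$), admissible if $f\sim g$ implies both defined or both constructors. $\approx_s$: equality or $f\sim g$ of equal arity with arguments related under a permutation preserving safe/normal status. $G_\downarrow=\{g\mid f\succ g,f\in G\}$; $\mathrm{Fun}(s)$. $>_{sq}$: $s=f(\ldots)>_{sq}t$ iff (1) $s_i\geqslant_{sq}t$, $i$ normal if $f\in\mathcal{D}$; or (2) $f\in\mathcal{D}$, $t=g(t_1..t_p)$, $f\succ g$, $s>_{sq}t_j$ all $j$. $>_{pop}$: (1) $s_i\geqslant_{pop}t$; (2) $f\in\mathcal{D}$, $t=g(t_1..t_m;t_{m+1}..t_{m+n})$, $f\succ g$, $s>_{sq}t_j$ for normal $j$, $s>_{pop}t_j$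 for safe $j$, at most one safe $t_j\notin\mathcal{T}(\mathrm{Fun}(s)_\downarrow,\mathcal{V})$; (3) $f\in\mathcal{D}$, $f\sim g$, normal arguments strictly and safe arguments weakly decreasing in the multiset extension of $>_{pop}$ modulo $\approx_s$ (weak versions add $\approx_s$). Predicative recursive: constructor TRS with $l>_{pop}r$ for all rules, for some safe mapping and admissible precedence. *)

(* Defs.v *)
From HB Require Import structures.
From Stdlib Require List.
From Stdlib Require Import Relation_Operators.
From mathcomp Require Import all_boot all_fingroup all_algebra.

Set Implicit Arguments.
Unset Strict Implicit.
Unset Printing Implicit Defensive.

(** * First-order terms *)

(* The symbols that are not [defd] are the constructors. *)
Record signature : Type := Signature {
  sym :> finType;
  arity : sym -> nat;
  defd : pred sym
}.

(* Raw terms; arities are enforced separately by [wf]. *)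
Inductive term (F : signature) : Type :=
| Var of nat
| App of F & seq (term F).
Arguments Var {F} _.
Arguments App {F} _ _.

Lemma term_ind_seq (F : signature) (P : term F -> Prop) :
  (forall x, P (Var x)) ->
  (forall f ts, foldr (fun t Q => P t /\ Q) True ts -> P (App f ts)) ->
  forall t, P t.
Proof.
move=> PV PA; fix IH 1 => -[x|f ts]; first exact: PV.
by apply: PA; elim: ts => //= t ts IHts; split.
Qed.

Fixpoint term_encode (F : signature) (t : term F) : GenTree.tree (nat + F) :=
  match t with
  | Var x => GenTree.Leaf (inl x)
  | App f ts =>
      GenTree.Node 0 (GenTree.Leaf (inr f) :: [seq term_encode t | t <- ts])
  end.

Fixpoint term_decode (F : signature) (t : GenTree.tree (nat + F)) : term F :=
  match t with
  | GenTree.Leaf (inl x) => Var x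
  | GenTree.Node _ (GenTree.Leaf (inr f) :: ts) =>
      App f [seq term_decode t | t <- ts]
  | _ => Var 0
  end.

Lemma term_encodeK (F : signature) : cancel (@term_encode F) (@term_decode F).
Proof.
elim/term_ind_seq => //= f ts IH; congr App.
by elim: ts IH => //= t ts IHts [-> /IHts ->].
Qed.

HB.instance Definition _ (F : signature) :=
  Countable.copy (term F) (can_type (@term_encodeK F)).

Fixpoint wf (F : signature) (t : term F) : bool :=
  match t with
  | Var _ => true
  | App f ts => (size ts == arity f) && all (@wf F) ts
  end.

(* Variables are listed with repetitions. *)
Fixpoint vars (F : signature) (t : term F) : seq nat :=
  match t with
  | Var x => [:: x]
  | App _ ts => flatten [seq vars t | t <- ts]
  end.

(* Fun(t) *)
Fixpoint funs (F : signature) (t : term F) : seq F :=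
  match t with
  | Var _ => [::]
  | App f ts => f :: flatten [seq funs t | t <- ts]
  end.

Fixpoint subst (F : signature) (sigma : nat -> term F) (t : term F) : term F :=
  match t with
  | Var x => sigma x
  | App f ts => App f [seq subst sigma t | t <- ts]
  end.

Fixpoint subterms (F : signature) (t : term F) : seq (term F) :=
  t :: match t with
       | Var _ => [::]
       | App _ ts => flatten [seq subterms t | t <- ts]
       end.

Definition proper_subterms (F : signature) (t : term F) : seq (term F) :=
  behead (subterms t).

Definition is_var (F : signature) (t : term F) : bool :=
  if t is Var _ then true else false.

(* Values may contain variables. *)
Fixpoint value (F : signature) (t : term F) : bool :=
  match t with
  | Var _ => true
  | App f ts => [&& ~~ defd f, size ts == arity f & all (@value F) ts]
  end.

Definition basic (F : signature) (t : term F) : bool :=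
  if t is App g vs then [&& defd g, size vs == arity g & all (@value F) vs]
  else false.

(** * Term rewrite systems *)

Definition rule (F : signature) : Type := (term F * term F)%type.

Definition trs (F : signature) : Type := seq (rule F).

Definition wf_rule (F : signature) (p : rule F) : bool :=
  [&& wf p.1, wf p.2, ~~ is_var p.1 & all (mem (vars p.1)) (vars p.2)].

Definition constructor_trs (F : signature) (R : trs F) : bool :=
  all (fun p => wf_rule p && basic p.1) R.

Inductive step (F : signature) (R : trs F) : term F -> term F -> Prop :=
| step_root l r sigma :
    (l, r) \in R -> step R (subst sigma l) (subst sigma r)
| step_arg f us s t vs :
    step R s t -> step R (App f (us ++ s :: vs)) (App f (us ++ t :: vs)).

Definition nf (F : signature) (R : trs F) (t : term F) : Prop :=
  forall u, ~ step R t u.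

Inductive istep (F : signature) (R : trs F) : term F -> term F -> Prop :=
| istep_root l r sigma :
    (l, r) \in R ->
    (forall u, u \in proper_subterms (subst sigma l) -> nf R u) ->
    istep R (subst sigma l) (subst sigma r)
| istep_arg f us s t vs :
    istep R s t -> istep R (App f (us ++ s :: vs)) (App f (us ++ t :: vs)).

Definition innermost_nf (F : signature) (R : trs F) (s t : term F) : Prop :=
  clos_refl_trans (term F) (istep R) s t /\ nf R t.

(* [sem R g vs w] is (vs, w) \in [[g]]. *)
Definition sem (F : signature) (R : trs F) (g : F) (vs : seq (term F))
    (w : term F) : Prop :=
  [/\ size vs = arity g, all (@value F) vs, value w
    & innermost_nf R (App g vs) w].

Definition left_linear (F : signature) (R : trs F) : bool :=
  all (fun p => uniq (vars p.1)) R.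

Definition variant (F : signature) (p q : rule F) : Prop :=
  exists2 rho : nat -> nat, bijective rho &
    q = (subst (fun x => Var (rho x)) p.1, subst (fun x => Var (rho x)) p.2).

(* Two terms with variables renamed apart are unifiable iff they have equal
   instances under two independent substitutions. *)
Definition unifiable_apart (F : signature) (s t : term F) : Prop :=
  exists sigma tau : nat -> term F, subst sigma s = subst tau t.

Definition non_overlapping (F : signature) (R : trs F) : Prop :=
  forall p q : rule F, p \in R -> q \in R ->
    (unifiable_apart p.1 q.1 -> variant p q) /\
    (forall u, u \in proper_subterms q.1 -> ~~ is_var u ->
       ~ unifiable_apart p.1 u).

Definition orthogonal (F : signature) (R : trs F) : Prop :=
  left_linear R /\ non_overlapping R.

(** * Safe mappings and precedences *)

(* [safe f i]: the argument position i (counted from 0) of f is safe. *)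
Definition safe_mapping (F : signature) (safe : F -> pred nat) : Prop :=
  forall (f : F) (i : nat), ~~ defd f -> i < arity f -> safe f i.

Definition safe_args (F : signature) (safe : F -> pred nat) (f : F)
    (ts : seq (term F)) : seq (term F) :=
  mask [seq safe f i | i <- iota 0 (size ts)] ts.

Definition normal_args (F : signature) (safe : F -> pred nat) (f : F)
    (ts : seq (term F)) : seq (term F) :=
  mask [seq ~~ safe f i | i <- iota 0 (size ts)] ts.

(* [prec f g] is f >= g; as symbols form a finite type, the strict part of a
   preorder is well-founded. *)
Definition precedence (F : signature) (prec : rel F) : Prop :=
  reflexive prec /\ transitive prec.

Definition prec_gt (F : signature) (prec : rel F) (f g : F) : bool :=
  prec f g && ~~ prec g f.

Definition prec_eq (F : signature) (prec : rel F) (f g : F) : bool :=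
  prec f g && prec g f.

Definition admissible (F : signature) (prec : rel F) : Prop :=
  forall f g : F, prec_eq prec f g -> defd f = defd g.

(* t is a term over G_down and the variables. *)
Definition term_below (F : signature) (prec : rel F) (G : seq F)
    (t : term F) : bool :=
  all (fun g => has (fun f => prec_gt prec f g) G) (funs t).

Inductive eqis (F : signature) (safe : F -> pred nat) (prec : rel F) :
    term F -> term F -> Prop :=
| eqis_refl t : eqis safe prec t t
| eqis_app f g ss ts (pi : {perm 'I_(arity f)}) :
    prec_eq prec f g ->
    arity f = arity g -> size ss = arity f -> size ts = arity g ->
    (forall i : 'I_(arity f), safe f i = safe g (pi i)) ->
    (forall i : 'I_(arity f),
       eqis safe prec (nth (Var 0) ss i) (nth (Var 0) ts (pi i))) ->
    eqis safe prec (App f ss) (App g ts).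

(** * Multiset extensions, multisets being represented by sequences *)

Definition mul_decrease (T : eqType) (gt eqv : T -> T -> Prop)
    (M N X Y : seq T) : Prop :=
  exists Z Z' : seq T,
    [/\ perm_eq M (X ++ Z), perm_eq N (Y ++ Z'), List.Forall2 eqv Z Z'
      & forall y, y \in Y -> exists2 x, x \in X & gt x y].

(* With X = [::] also Y = [::], so that M and N are equal modulo eqv. *)
Definition mul_ge (T : eqType) (gt eqv : T -> T -> Prop) (M N : seq T) : Prop :=
  exists X Y : seq T, mul_decrease gt eqv M N X Y.

Definition mul_gt (T : eqType) (gt eqv : T -> T -> Prop) (M N : seq T) : Prop :=
  exists X Y : seq T, X != [::] /\ mul_decrease gt eqv M N X Y.

(** * The polynomial path order *)

Inductive gt_sq (F : signature) (safe : F -> pred nat) (prec : rel F) :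
    term F -> term F -> Prop :=
| gt_sq_arg f ss t i :
    i < size ss -> (defd f -> ~~ safe f i) ->
    gt_sq safe prec (nth (Var 0) ss i) t \/ eqis safe prec (nth (Var 0) ss i) t ->
    gt_sq safe prec (App f ss) t
| gt_sq_prec f g ss ts :
    defd f -> prec_gt prec f g ->
    (forall t, t \in ts -> gt_sq safe prec (App f ss) t) ->
    gt_sq safe prec (App f ss) (App g ts).

Inductive gt_pop (F : signature) (safe : F -> pred nat) (prec : rel F) :
    term F -> term F -> Prop :=
| gt_pop_arg f ss s t :
    s \in ss -> gt_pop safe prec s t \/ eqis safe prec s t ->
    gt_pop safe prec (App f ss) t
| gt_pop_prec f g ss ts :
    defd f -> prec_gt prec f g ->
    (forall t, t \in normal_args safe g ts -> gt_sq safe prec (App f ss) t) ->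
    (forall t, t \in safe_args safe g ts -> gt_pop safe prec (App f ss) t) ->
    count (fun t => ~~ term_below prec (funs (App f ss)) t)
      (safe_args safe g ts) <= 1 ->
    gt_pop safe prec (App f ss) (App g ts)
| gt_pop_rec f g ss ts :
    defd f -> prec_eq prec f g ->
    mul_gt (gt_pop safe prec) (eqis safe prec)
      (normal_args safe f ss) (normal_args safe g ts) ->
    mul_ge (gt_pop safe prec) (eqis safe prec)
      (safe_args safe f ss) (safe_args safe g ts) ->
    gt_pop safe prec (App f ss) (App g ts).

Definition predicative_recursive (F : signature) (R : trs F) : Prop :=
  constructor_trs R /\
  exists (safe : F -> pred nat) (prec : rel F),
    [/\ safe_mapping safe, precedence prec, admissible prec
      & forall l r, (l, r) \in R -> gt_pop safe prec l r].

(** * Binary notation *)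

(* Natural numbers are written with the digits 1 (false) and 2 (true), least
   significant digit first: S_i denotes x |-> 2x + i, and every number has
   exactly one representation. *)
Fixpoint dyadic_succ (w : seq bool) : seq bool :=
  match w with
  | [::] => [:: false]
  | false :: w' => true :: w'
  | true :: w' => false :: dyadic_succ w'
  end.

Definition dyadic (n : nat) : seq bool := iter n dyadic_succ [::].

Definition dyadic_val (w : seq bool) : nat :=
  foldr (fun (b : bool) n => n.*2 + b.+1) 0 w.

Lemma dyadic_val_succ w : dyadic_val (dyadic_succ w) = (dyadic_val w).+1.
Proof.
elim: w => //= -[] w IH //=; last by rewrite addn2 addn1.
by rewrite IH doubleS addn1 addn2.
Qed.

Lemma dyadicK : cancel dyadic dyadic_val.
Proof. by elim=> //= n IH; rewrite dyadic_val_succ IH. Qed.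

Lemma dyadic_double n : dyadic (n.*2 + 1) = false :: dyadic n.
Proof.
elim: n => // n IH; rewrite doubleS addn1 /dyadic 2!iterS.
by move: IH; rewrite addn1 /dyadic => ->.
Qed.

Lemma dyadic_valK : cancel dyadic_val dyadic.
Proof.
elim=> // -[] w IH /=; last by rewrite dyadic_double IH.
by rewrite addn2 /dyadic iterS -/(dyadic _) -addn1 dyadic_double IH.
Qed.

Definition numeral (F : signature) (e s1 s2 : F) (n : nat) : term F :=
  foldr (fun b t => App (if b then s2 else s1) [:: t]) (App e [::]) (dyadic n).

Definition binary_constructors (F : signature) (e s1 s2 : F) : Prop :=
  [/\ [&& ~~ defd e, ~~ defd s1 & ~~ defd s2], s1 != s2,
      arity e = 0, arity s1 = 1 & arity s2 = 1].

(* [[g]] is compared with the graph of f on all values, including open ones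
   and those built from further constructors. *)
Definition computes (F : signature) (R : trs F) (k : nat)
    (f : k.-tuple nat -> nat) : Prop :=
  exists e s1 s2 g : F,
    [/\ binary_constructors e s1 s2, defd g, arity g = k
      & forall (vs : seq (term F)) (w : term F),
          sem R g vs w <->
          exists x : k.-tuple nat,
            vs = [seq numeral e s1 s2 n | n <- x] /\ w = numeral e s1 s2 (f x)].

(** * Polynomial-time computable functions *)

Inductive move : Type := MoveLeft | MoveRight | Stay.

(* Deterministic machines with one two-way infinite tape; [delta] is undefined
   exactly where the machine halts. *)
Record machine : Type := Machine {
  state : finType;
  letter : finType;
  start : state;
  blank : letter;
  sep : letter;
  bit : bool -> letter;
  letters_uniq : uniq [:: blank; sep; bit false; bit true];
  delta : state -> letter -> option (state * letter * move)
}.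

(* [cleft] lists the cells to the left of the head, nearest first, [cright]
   those to its right; all cells not listed are blank. *)
Record config (M : machine) : Type := Config {
  cstate : state M;
  cleft : seq (letter M);
  chead : letter M;
  cright : seq (letter M)
}.

Definition tm_step (M : machine) (c : config M) : config M :=
  match delta (cstate c) (chead c) with
  | None => c
  | Some (q, a, Stay) => Config q (cleft c) a (cright c)
  | Some (q, a, MoveLeft) =>
      Config q (behead (cleft c)) (head (blank M) (cleft c)) (a :: cright c)
  | Some (q, a, MoveRight) =>
      Config q (a :: cleft c) (head (blank M) (cright c)) (behead (cright c))
  end.

Definition tm_halted (M : machine) (c : config M) : bool :=
  ~~ isSome (delta (cstate c) (chead c)).

Definition tm_init (M : machine) (ws : seq (seq bool)) : config M :=
  let s := flatten [seq rcons [seq bit M b | b <- w] (sep M) | w <- ws] in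
  Config (start M) [::] (head (blank M) s) (behead s).

Fixpoint read_bits (M : machine) (s : seq (letter M)) : seq bool :=
  if s is a :: s' then
    if a == bit M false then false :: read_bits s'
    else if a == bit M true then true :: read_bits s'
    else [::]
  else [::].

(* The output is the maximal word of digits starting at the head. *)
Definition tm_output (M : machine) (c : config M) : seq bool :=
  read_bits (chead c :: cright c).

Definition input_size (k : nat) (x : k.-tuple nat) : nat :=
  \sum_(n <- x) size (dyadic n).

(* [tm_step] leaves halted configurations unchanged, so being halted after
   p.[n] steps means halting within p.[n] steps. *)
Definition polytime (k : nat) (f : k.-tuple nat -> nat) : Prop :=
  exists (M : machine) (p : {poly nat}),
    forall x : k.-tuple nat,
      let c := iter (p.[input_size x])%R (@tm_step M)
                 (tm_init M [seq dyadic n | n <- x]) in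
      tm_halted c /\ tm_output c = dyadic (f x).

(* Main.v *)
From HB Require Import structures.
From Stdlib Require List.
From Stdlib Require Import Relation_Operators.
From mathcomp Require Import all_boot all_algebra.
Require Import Defs.

(** A Turing machine is simulated directly. Configurations are terms
    [Conf q a (l, r)] over words of tape letters, numerals being words of digit
    letters, and one machine step is a pattern-matching function of a safe
    argument. With [y] a word of length [n], the functions
      [Iter (j+1) (a x, y; e) -> Iter j (y, y; Iter (j+1) (x, y; e))]
    and [Iter 0 (x, y; e) -> Step (; e)] make [Iter d (y, y; e)] perform [n ^ d]
    steps, which exceeds the running time for a suitable [d] once [y] is the
    input padded by a constant. A precedence given by a rank orients all rules.

    That the main symbol denotes nothing but the graph of [f] follows from a
    model of the rules: rewriting preserves denotations, the denotation
    determines a closed word, and unless all inputs are numerals the clock [y]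
    is not closed, on which [Iter], hence the main call, is stuck. *)

Set Implicit Arguments.
Unset Strict Implicit.
Unset Printing Implicit Defensive.

(** * Innermost rewriting in constructor systems *)

Section ConstructorSystems.
Variables (F : signature) (R : trs F).
Hypothesis cR : constructor_trs R.

Lemma subterm_value (t u : term F) : value t -> u \in subterms t -> value u.
Proof.
elim/term_ind_seq: t u => [x|f ts IH] u; first by rewrite /= inE => _ /eqP->.
move=> vt; rewrite /= inE => /predU1P[->//|].
case/and3P: vt => _ _; elim: ts IH => //= t ts IHts [IHt {}/IHts IHts].
by case/andP=> vt vts; rewrite mem_cat => /orP[/(IHt _ vt)|/(IHts vts)].
Qed.

Lemma proper_subterm_value f (vs : seq (term F)) u :
  all (@value F) vs -> u \in proper_subterms (App f vs) -> value u.
Proof.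
rewrite /proper_subterms /=; elim: vs => //= v vs IH /andP[vv vvs].
by rewrite mem_cat => /orP[/(subterm_value vv)|/(IH vvs)].
Qed.

Lemma lhs_basic p : p \in R -> basic p.1.
Proof. by move=> pR; have /allP/(_ _ pR)/andP[] := cR. Qed.

(** Every redex is rooted by a defined symbol, and no defined symbol occurs in a value. *)
Lemma value_nf t : value t -> nf R t.
Proof.
move=> vt u st; elim: st vt => {t u} [l r sigma /lhs_basic|f us s t vs _ IH].
  by case: l => //= f ts /andP[df _] /andP[/negP].
by rewrite /= all_cat /= => /and3P[_ _ /and3P[_ /IH]].
Qed.

(** Proper subterms of a basic left-hand side are values, so those that are not variables have a
    constructor root and unify with no left-hand side. Only overlaps at the root remain to be
    excluded. *)
Lemma constructor_non_overlapping :
  (forall p q, p \in R -> q \in R -> unifiable_apart p.1 q.1 -> p = q) ->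
  non_overlapping R.
Proof.
move=> uR p q pR qR; split=> [/(uR p q pR qR) <-|u].
  exists id; first by exists id.
  have sV (t : term F) : subst (fun x => Var x) t = t.
    elim/term_ind_seq: t => //= f ts IH; congr App.
    by elim: ts IH => //= t ts IH [-> /IH ->].
  by rewrite !sV; case: (p).
case: q qR => -[x|f ts] r /lhs_basic //= /and3P[_ _ vts] /(proper_subterm_value vts).
case: p pR => -[x|g us] r' /lhs_basic //= /and3P[dg _ _].
by case: u => //= h ws /andP[dh _] _ [sigma [tau [E _]]]; rewrite -E dg in dh.
Qed.

Definition ired := clos_refl_trans (term F) (istep R).

Lemma ired_trans t s u : ired s t -> ired t u -> ired s u.
Proof. exact: rt_trans. Qed.

(** Instances enter through equations so that they can be given in simplified form. Value arguments
    are normal forms, which makes the step innermost. *)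
Lemma ired_rule p sigma s t :
    p \in R -> subst sigma p.1 = s -> subst sigma p.2 = t ->
    (if s is App _ vs then all (@value F) vs else false) -> ired s t.
Proof.
case: p => l r lr /= <- <-; case El: (subst sigma l) => [//|f vs] vvs.
rewrite -El; apply: rt_step; apply: istep_root => // u.
by rewrite El => /(proper_subterm_value vvs)/value_nf.
Qed.

Lemma ired_arg f us s t vs :
  ired s t -> ired (App f (us ++ s :: vs)) (App f (us ++ t :: vs)).
Proof.
elim=> [x y st|x|x y z _ IH1 _ IH2]; last exact: ired_trans IH1 IH2.
  by apply: rt_step; apply: istep_arg.
exact: rt_refl.
Qed.

(** The prefix [us] serves the induction: arguments already reduced move into it. *)
Lemma ired_args f us ss ts :
  List.Forall2 ired ss ts -> ired (App f (us ++ ss)) (App f (us ++ ts)).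
Proof.
move=> H; elim: H us => [|s t {}ss {}ts st _ IH] us; first exact: rt_refl.
apply: (ired_trans (ired_arg f us ss st)).
by rewrite -!cat_rcons; apply: IH.
Qed.

Lemma ired_app f ss ts t :
  List.Forall2 ired ss ts -> ired (App f ts) t -> ired (App f ss) t.
Proof. by move/(@ired_args f [::])/ired_trans; apply. Qed.

End ConstructorSystems.

Arguments ired {F} R.
Arguments ired_trans {F R}.

(** * Sufficient conditions for the path orders *)

Section PathOrders.
Variables (F : signature) (safe : F -> pred nat) (prec : rel F).

Lemma mul_decrease_catr (T : eqType) (gt eqv : T -> T -> Prop) X Y Z :
  (forall z, eqv z z) -> (forall y, y \in Y -> exists2 x, x \in X & gt x y) ->
  mul_decrease gt eqv (X ++ Z) (Y ++ Z) X Y.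
Proof. by move=> rE H; exists Z, Z; split=> //; elim: (Z); constructor. Qed.

Lemma mul_gt_cons (T : eqType) (gt eqv : T -> T -> Prop) x y Z :
  (forall z, eqv z z) -> gt x y -> mul_gt gt eqv (x :: Z) (y :: Z).
Proof.
move=> rE xy; exists [:: x], [:: y]; split=> //.
apply: (@mul_decrease_catr _ gt eqv [:: x] [:: y]) => // z.
by rewrite inE => /eqP->; exists x; rewrite ?mem_head.
Qed.

Lemma mul_ge_refl (T : eqType) (gt eqv : T -> T -> Prop) Z :
  (forall z, eqv z z) -> mul_ge gt eqv Z Z.
Proof.
by move=> rE; exists [::], [::]; apply: (@mul_decrease_catr _ _ _ [::] [::]).
Qed.

(** Repeated use of the precedence clause reduces the comparison to the variables of [t]. *)
Lemma gt_sq_below f ss t :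
  defd f -> all (prec_gt prec f) (funs t) ->
  (forall x, x \in vars t -> gt_sq safe prec (App f ss) (Var x)) ->
  gt_sq safe prec (App f ss) t.
Proof.
move=> df; elim/term_ind_seq: t => [x|g ts IH] /= ft vt; first exact/vt/mem_head.
case/andP: ft => fg ft; apply: gt_sq_prec => // t.
elim: ts IH ft vt => //= u us IHus [IHu /IHus{}IHus].
rewrite all_cat => /andP[fu fus] vt; rewrite inE => /predU1P[->|].
  by apply: IHu => // x xu; apply: vt; rewrite mem_cat xu.
by apply: IHus => // x xu; apply: vt; rewrite mem_cat xu orbT.
Qed.

Lemma gt_pop_var f ss x :
  x \in vars (App f ss) -> gt_pop safe prec (App f ss) (Var x).
Proof.
have H (t : term F) :
    x \in vars t -> gt_pop safe prec t (Var x) \/ eqis safe prec t (Var x).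
  elim/term_ind_seq: t => [y|g ts IH] /=.
    by rewrite inE => /eqP->; right; apply: eqis_refl.
  move=> xts; left.
  have [t tts xt] : exists2 t, t \in ts &
      gt_pop safe prec t (Var x) \/ eqis safe prec t (Var x).
    elim: ts IH xts => //= u us IHus [IHu /IHus{}IHus].
    rewrite mem_cat => /orP[/IHu xu|/IHus[t tus xt]]; first by exists u; rewrite ?mem_head.
    by exists t; rewrite ?inE ?tus ?orbT.
  exact: gt_pop_arg tts xt.
by case/H => // E; inversion E.
Qed.

(** All arguments of a constructor are safe, so the precedence clause leaves no [gt_sq] obligation;
    all of them lie below [f], so the count of exceptional safe arguments is 0. *)
Lemma gt_pop_constructors f ss t :
  defd f -> safe_mapping safe -> wf t ->
  all (fun g => ~~ defd g && prec_gt prec f g) (funs t) ->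
  all (mem (vars (App f ss))) (vars t) ->
  gt_pop safe prec (App f ss) t.
Proof.
move=> df sS; elim/term_ind_seq: t => [x|g ts IH].
  by rewrite /= andbT => _ _ /gt_pop_var.
rewrite [wf _]/= [funs _]/= [vars (App g ts)]/=.
move=> /andP[/eqP sz wts] /andP[/andP[dg fg] fts] vts.
have sub u : u \in ts -> {subset funs u <= flatten [seq funs t | t <- ts]} /\
    {subset vars u <= flatten [seq vars t | t <- ts]}.
  by move=> uts; split=> x xu; apply/flatten_mapP; exists u.
have nE : normal_args safe g ts = [::].
  rewrite /normal_args (_ : map _ _ = nseq (size ts) false) ?mask_false //.
  apply: (@eq_from_nth _ false); rewrite size_map size_iota ?size_nseq // => i lti.
  by rewrite (nth_map 0) ?size_iota // nth_iota // nth_nseq lti sS // -sz.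
apply: gt_pop_prec => //; rewrite ?nE //.
- move=> t /mem_mask tts; have [fS vS] := sub t tts.
  have {}IH : wf t -> all (fun g => ~~ defd g && prec_gt prec f g) (funs t) ->
      all (mem (vars (App f ss))) (vars t) -> gt_pop safe prec (App f ss) t.
    by elim: (ts) IH tts => //= u us IHus [IHu /IHus{}IHus]; rewrite inE => /predU1P[->|].
  apply: IH; first exact: (allP wts).
    by apply/allP=> h /fS/(allP fts).
  by apply/allP=> h /vS/(allP vts).
- rewrite (_ : count _ _ = 0) //; apply/eqP; rewrite -leqn0 leqNgt -has_count.
  apply/hasPn=> t /mem_mask tts; have [fS _] := sub t tts.
  rewrite negbK; apply/allP=> h /fS/(allP fts)/andP[_ fh].
  by rewrite /= fh.
Qed.

End PathOrders.

(** * The simulating system *)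

Section Simulation.
Variables (M : machine) (k m c : nat).

Local Notation letterM := (letter M).
Local Notation stateM := (state M).

(** State and scanned letter belong to the symbol [Conf], whose arguments are the two half-tapes,
    nearest cell first. The levels of [Iter] range from 0 to [m.+1]. *)
Inductive tsym : Type :=
| Nil | Let of letterM | Conf of stateM & letterM
| Step | Init | Enc | Iter of 'I_m.+2 | Read | Out | Main.

Definition tsym_code (f : tsym) : 'I_7 + (letterM + (stateM * letterM + 'I_m.+2)) :=
  match f with
  | Nil => inl (inord 0) | Step => inl (inord 1) | Init => inl (inord 2)
  | Enc => inl (inord 3) | Read => inl (inord 4) | Out => inl (inord 5)
  | Main => inl (inord 6)
  | Let a => inr (inl a)
  | Conf q a => inr (inr (inl (q, a)))
  | Iter j => inr (inr (inr j))
  end.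

(** Code 6 lies beyond the list and yields the default [Main]. *)
Definition tsym_decode (x : 'I_7 + (letterM + (stateM * letterM + 'I_m.+2))) :=
  match x with
  | inl i => nth Main [:: Nil; Step; Init; Enc; Read; Out] i
  | inr (inl a) => Let a
  | inr (inr (inl qa)) => Conf qa.1 qa.2
  | inr (inr (inr j)) => Iter j
  end.

Lemma tsym_codeK : cancel tsym_code tsym_decode.
Proof. by case=> //=; rewrite inordK. Qed.

HB.instance Definition _ := Finite.copy tsym (can_type tsym_codeK).

Definition tarity (f : tsym) : nat :=
  match f with
  | Nil => 0 | Let _ => 1 | Conf _ _ => 2 | Step => 1 | Init => 1
  | Enc => 2 | Iter _ => 3 | Read => 1 | Out => 1 | Main => k
  end.

(** Rank 0 singles out the constructors. Each level of [Iter] lies above the previous one, the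
    lowest above [Step], and [Main] above the top level, whose rank is [m.+3]. *)
Definition trank (f : tsym) : nat :=
  match f with
  | Nil | Let _ | Conf _ _ => 0
  | Step | Init | Enc | Read => 1
  | Out => 2
  | Iter j => j.+2
  | Main => m.+4
  end.

Definition tsig : signature :=
  @Signature tsym tarity (fun f : tsym => 0 < trank f).

Local Notation T := (term tsig).

Definition ap (f : tsym) (ts : seq T) : T := @App tsig f ts.

(** [None] is an exhausted half-tape. Separate patterns for the two cases keep the rules for [Step]
    from overlapping. *)
Definition letpat (x : nat) (oa : option letterM) : T :=
  if oa is Some a then ap (Let a) [:: Var x] else ap Nil [::].

Definition tailpat (x : nat) (oa : option letterM) : T :=
  if oa is Some _ then Var x else ap Nil [::].

Definition is_bit (a : letterM) : bool := (a == bit M false) || (a == bit M true).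

Definition word (s : seq letterM) : T :=
  foldr (fun a t => ap (Let a) [:: t]) (ap Nil [::]) s.

Definition encs (ts : seq T) (t : T) : T :=
  foldr (fun u v => ap Enc [:: u; v]) t ts.

(** The padding by [c] blanks turns the tape length [n] into [n + c], the base of the time bound. *)
Definition main_rhs (ts : seq T) : T :=
  let clock := encs ts (word (nseq c (blank M))) in
  ap Out [:: ap (Iter ord_max)
               [:: clock; clock; ap Init [:: encs ts (ap Nil [::])]]].

(** Halted configurations step to themselves, as under [tm_step], so a clock that runs too long does
    no harm. *)
Definition step_rhs (q : stateM) (a : letterM) (ol or : option letterM) : T :=
  match delta q a with
  | None => ap (Conf q a) [:: letpat 0 ol; letpat 1 or]
  | Some (q', a', Stay) => ap (Conf q' a') [:: letpat 0 ol; letpat 1 or]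
  | Some (q', a', MoveLeft) =>
      ap (Conf q' (odflt (blank M) ol))
        [:: tailpat 0 ol; ap (Let a') [:: letpat 1 or]]
  | Some (q', a', MoveRight) =>
      ap (Conf q' (odflt (blank M) or))
        [:: ap (Let a') [:: letpat 0 ol]; tailpat 1 or]
  end.

Inductive ridx : Type :=
| EncBit of bool | EncNil | InitNil | InitLet of letterM
| StepConf of stateM & letterM & option letterM & option letterM
| Iter0 | IterNil of 'I_m.+1 | IterLet of 'I_m.+1 & letterM
| OutConf of stateM & letterM | ReadNil | ReadLet of letterM | MainRule.

Local Notation ridx_sum :=
  ('I_5 + (bool + (letterM + (stateM * letterM * option letterM * option letterM
    + ('I_m.+1 + ('I_m.+1 * letterM + (stateM * letterM + letterM)))))))%type.

Definition ridx_code (i : ridx) : ridx_sum :=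
  match i with
  | EncNil => inl (inord 0) | InitNil => inl (inord 1) | Iter0 => inl (inord 2)
  | ReadNil => inl (inord 3) | MainRule => inl (inord 4)
  | EncBit b => inr (inl b)
  | InitLet a => inr (inr (inl a))
  | StepConf q a ol or => inr (inr (inr (inl (q, a, ol, or))))
  | IterNil j => inr (inr (inr (inr (inl j))))
  | IterLet j a => inr (inr (inr (inr (inr (inl (j, a))))))
  | OutConf q a => inr (inr (inr (inr (inr (inr (inl (q, a)))))))
  | ReadLet a => inr (inr (inr (inr (inr (inr (inr a))))))
  end.

Definition ridx_decode (x : ridx_sum) : ridx :=
  match x with
  | inl i => nth MainRule [:: EncNil; InitNil; Iter0; ReadNil] i
  | inr (inl b) => EncBit b
  | inr (inr (inl a)) => InitLet a
  | inr (inr (inr (inl (q, a, ol, or)))) => StepConf q a ol or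
  | inr (inr (inr (inr (inl j)))) => IterNil j
  | inr (inr (inr (inr (inr (inl (j, a)))))) => IterLet j a
  | inr (inr (inr (inr (inr (inr (inl (q, a))))))) => OutConf q a
  | inr (inr (inr (inr (inr (inr (inr a)))))) => ReadLet a
  end.

Lemma ridx_codeK : cancel ridx_code ridx_decode.
Proof. by case=> //=; rewrite inordK. Qed.

HB.instance Definition _ := Finite.copy ridx (can_type ridx_codeK).

Definition iterS (j : 'I_m.+1) : tsym := Iter (lift ord0 j).
Definition iterW (j : 'I_m.+1) : tsym := Iter (widen_ord (leqnSn _) j).

Definition rule_of (i : ridx) : rule tsig :=
  match i with
  | EncBit b =>
      (ap Enc [:: ap (Let (bit M b)) [:: Var 0]; Var 1],
       ap (Let (bit M b)) [:: ap Enc [:: Var 0; Var 1]])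
  | EncNil => (ap Enc [:: ap Nil [::]; Var 1], ap (Let (sep M)) [:: Var 1])
  | InitNil =>
      (ap Init [:: ap Nil [::]],
       ap (Conf (start M) (blank M)) [:: ap Nil [::]; ap Nil [::]])
  | InitLet a =>
      (ap Init [:: ap (Let a) [:: Var 0]],
       ap (Conf (start M) a) [:: ap Nil [::]; Var 0])
  | StepConf q a ol or =>
      (ap Step [:: ap (Conf q a) [:: letpat 0 ol; letpat 1 or]],
       step_rhs q a ol or)
  | Iter0 => (ap (Iter ord0) [:: Var 0; Var 1; Var 2], ap Step [:: Var 2])
  | IterNil j => (ap (iterS j) [:: ap Nil [::]; Var 1; Var 2], Var 2)
  | IterLet j a =>
      (ap (iterS j) [:: ap (Let a) [:: Var 0]; Var 1; Var 2],
       ap (iterW j) [:: Var 1; Var 1; ap (iterS j) [:: Var 0; Var 1; Var 2]])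
  | OutConf q a =>
      (ap Out [:: ap (Conf q a) [:: Var 0; Var 1]],
       ap Read [:: ap (Let a) [:: Var 1]])
  | ReadNil => (ap Read [:: ap Nil [::]], ap Nil [::])
  | ReadLet a =>
      (ap Read [:: ap (Let a) [:: Var 0]],
       if is_bit a then ap (Let a) [:: ap Read [:: Var 0]] else ap Nil [::])
  | MainRule =>
      (ap Main [seq Var i | i <- iota 0 k],
       main_rhs [seq Var i | i <- iota 0 k])
  end.

Definition tR : trs tsig := [seq rule_of i | i <- enum {: ridx}].

Lemma rule_of_in i : rule_of i \in tR.
Proof. by rewrite map_f ?mem_enum. Qed.

Lemma tRP p : p \in tR -> exists i, p = rule_of i.
Proof. by case/mapP=> i _ ->; exists i. Qed.

(** * Orthogonality *)

Lemma encs_wf ts t : wf (encs ts t) = all (@wf tsig) ts && wf t.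
Proof. by elim: ts => //= u ts ->; rewrite andbT andbA. Qed.

Lemma word_wf s : wf (word s).
Proof. by elim: s => //= a s ->. Qed.

Lemma vars_encs ts t : vars (encs ts t) = flatten [seq vars t | t <- ts] ++ vars t.
Proof. by elim: ts => //= u ts ->; rewrite cats0 catA. Qed.

Lemma vars_word s : vars (word s) = [::].
Proof. by elim: s => //= a s ->. Qed.

Lemma vars_vars s : flatten [seq vars t | t <- [seq @Var tsig i | i <- s]] = s.
Proof. by elim: s => //= i s ->. Qed.

Lemma tR_constructor : constructor_trs tR.
Proof.
apply/allP=> p /tRP[i ->] {p}; rewrite /wf_rule.
case: i => //= [q a ol or|a|].
- rewrite /step_rhs; case: (delta q a) => [[[q' a'] []]|];
  by case: ol => [b|]; case: or => [b'|].
- by case: ifP.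
- rewrite size_map size_iota eqxx /= !encs_wf word_wf !vars_encs vars_word.
  rewrite !vars_vars !cats0 /= !all_cat /= !andbT.
  have -> : all (@wf tsig) [seq Var i | i <- iota 0 k] by rewrite all_map; apply/allP.
  have -> : all (@value tsig) [seq Var i | i <- iota 0 k] by rewrite all_map; apply/allP.
  by rewrite !andbb !andbT; apply/allP.
Qed.

Definition head_letter (t : T) : option letterM :=
  if t is App f _ then if (f : tsym) is Let a then Some a else None else None.

Definition head_conf (t : T) : option (stateM * letterM) :=
  if t is App f _ then if (f : tsym) is Conf q a then Some (q, a) else None
  else None.

(* Left-hand sides are pairwise non-unifiable because every instance of one
   determines its rule. *)
Definition match_rule (t : T) : option ridx :=
  if t is App f (u :: us) then
    match (f : tsym) with
    | Enc => if head_letter u is Some a then Some (EncBit (a == bit M true))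
             else Some EncNil
    | Init => if head_letter u is Some a then Some (InitLet a) else Some InitNil
    | Step =>
        if u is App g [:: l; r] then
          if head_conf u is Some (q, a)
          then Some (StepConf q a (head_letter l) (head_letter r)) else None
        else None
    | Iter i =>
        if unlift ord0 i is Some j then
          if head_letter u is Some a then Some (IterLet j a) else Some (IterNil j)
        else Some Iter0
    | Out => if head_conf u is Some (q, a) then Some (OutConf q a) else None
    | Read => if head_letter u is Some a then Some (ReadLet a) else Some ReadNil
    | Main => Some MainRule
    | _ => None
    end
  else Some MainRule.

Lemma bit_inj : injective (bit M).
Proof.
have /= := letters_uniq M; rewrite !inE !negb_or andbT => /and3P[_ _ /negP nb].
by case=> -[] // E; case: nb; rewrite E.
Qed.

Lemma match_ruleK i sigma : match_rule (subst sigma (rule_of i).1) = Some i.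
Proof.
case: i => //= [b|q a ol or||j|j a|].
- by rewrite (inj_eq bit_inj); case: b.
- by case: ol => [?|]; case: or => [?|].
- by rewrite unlift_none.
- by rewrite liftK.
- by rewrite liftK.
(* For [k = 0] the call of [Main] has no argument and falls into the last branch of [match_rule]. *)
- by case: (iota 0 k).
Qed.

Lemma tR_orthogonal : orthogonal tR.
Proof.
split.
  apply/allP=> p /tRP[i ->]; case: i => //= [q a ol or|].
    by case: ol => [?|]; case: or => [?|].
  by rewrite vars_vars iota_uniq.
apply: (constructor_non_overlapping tR_constructor) => p q.
move=> /tRP[i ->] /tRP[j ->] [sigma [tau E]].
by have := match_ruleK i sigma; rewrite E match_ruleK => -[->].
Qed.

(** * Compatibility with the polynomial path order *)

(** Arguments that drive a recursion are normal, and recursive results are passed on in safe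
    positions. [Out] hands its argument to the recursion of [Read], so it is normal too. *)
Definition tsafe (f : tsig) (i : nat) : bool :=
  match (f : tsym) with
  | Main | Read | Out => false
  | Enc => i == 1
  | Iter _ => i == 2
  | _ => true
  end.

Definition tprec (f g : tsig) : bool := trank g <= trank f.

Lemma tsafe_mapping : safe_mapping tsafe.
Proof. by move=> f i; case: f. Qed.

Lemma tprec_gtE (f g : tsig) : prec_gt tprec f g = (trank g < trank f).
Proof. by rewrite /prec_gt /tprec -ltnNge andb_idl // => /ltnW. Qed.

Lemma all_funs_encs (P : pred tsig) ts t :
  all P (funs (encs ts t)) =
    all (fun u => P (Enc : tsig) && all P (funs u)) ts && all P (funs t).
Proof.
by elim: ts => //= u ts IH; rewrite cats0 all_cat IH !andbA.
Qed.

Lemma funs_word_rank s : all (fun g : tsig => trank g == 0) (funs (word s)).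
Proof. by elim: s => //= a s IH; rewrite cats0. Qed.

Lemma tR_gt_pop l r : (l, r) \in tR -> gt_pop tsafe tprec l r.
Proof.
move=> lrR; case/allP/(_ _ lrR)/andP: (tR_constructor) => /and4P[_ /= wr _ vr] bl.
(* Settles at once all rules whose right-hand side consists of constructors and variables. *)
have constr_case : all (fun g : tsig => trank g == 0) (funs r) ->
    gt_pop tsafe tprec l r.
  case: l bl vr {lrR} => // f ss /and3P[df _ _] vr r0.
  apply: gt_pop_constructors => //; first exact: tsafe_mapping.
  by apply: sub_all r0 => g /eqP g0; rewrite tprec_gtE /= g0.
have rE := @eqis_refl tsig tsafe tprec.
case/tRP: lrR => i Ei.
have [El Er] : l = (rule_of i).1 /\ r = (rule_of i).2 by rewrite -Ei.
rewrite {}El {}Er {Ei wr vr bl} in constr_case *.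
case: i constr_case => [b|||a|q a ol or||j|j a|q a||a|] constr_case.
- apply: gt_pop_prec => //= t; rewrite inE => /eqP->.
  apply: gt_pop_rec => //=; last exact: mul_ge_refl.
  by apply: mul_gt_cons => //; apply: gt_pop_var.
- exact: constr_case.
- exact: constr_case.
- exact: constr_case.
- apply: constr_case; rewrite /= /step_rhs.
  by case: (delta q a) => [[[q' a'] []]|]; case: ol => [b|]; case: or => [b'|].
- apply: gt_pop_prec => //= t; rewrite inE => /eqP->.
  exact: gt_pop_var.
- exact: constr_case.
(* The lower level receives [Var 1] twice, a normal argument of the left-hand side. The recursive
   call is its only safe argument, hence the one exception allowed, and decreases in the first
   normal argument. *)
- apply: gt_pop_prec => //; rewrite ?tprec_gtE //=.
  + move=> t; rewrite !inE orbb => /eqP->.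
    by apply: (@gt_sq_arg _ _ _ _ _ _ 1) => //; right.
  + move=> t; rewrite inE => /eqP->.
    apply: gt_pop_rec => //=; last exact: mul_ge_refl.
      by rewrite /prec_eq /tprec leqnn.
    by apply: mul_gt_cons => //; apply: gt_pop_var.
  + by rewrite addn0 leq_b1.
- apply: gt_pop_prec => //= t; rewrite inE => /eqP->.
  apply: gt_sq_below => //= x; rewrite inE => /eqP->.
  (* The variable is reached through the normal argument of [Out] and then inside the constructor
     [Conf]. *)
  apply: (@gt_sq_arg _ _ _ _ _ _ 0) => //; left.
  by apply: (@gt_sq_arg _ _ _ _ _ _ 1) => //; right.
- exact: constr_case.
- move: constr_case; rewrite /=; case: ifP => _ constr_case; last exact: constr_case.
  apply: gt_pop_prec => //= t; rewrite inE => /eqP->.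
  apply: gt_pop_rec => //=; last exact: mul_ge_refl.
  by apply: mul_gt_cons => //; apply: gt_pop_var.
(* The argument of [Out] is normal, but [gt_sq] admits any composition of symbols below [Main],
   whose arguments are all normal. *)
- apply: gt_pop_prec => //= t; rewrite inE => /eqP->.
  have encs_below u : all (fun g : tsig => trank g == 0) (funs u) ->
      all (prec_gt tprec (Main : tsig))
        (funs (encs [seq Var i | i <- iota 0 k] u)).
    move=> u0; rewrite all_funs_encs all_map tprec_gtE; apply/andP; split.
      by apply/allP.
    by apply: sub_all u0 => g /eqP g0; rewrite tprec_gtE g0.
  apply: gt_sq_below => //=.
    rewrite !cats0 !all_cat /= !encs_below //; last exact: funs_word_rank.
    by rewrite !tprec_gtE /= ltnSn.
  move=> x; rewrite !vars_encs vars_word vars_vars !cats0 !mem_cat !orbb.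
  rewrite mem_iota add0n => /andP[_ xk].
  apply: (@gt_sq_arg _ _ _ _ _ _ x) => //; first by rewrite size_map size_iota.
  by right; rewrite (nth_map 0) ?size_iota // nth_iota.
Qed.

Lemma tR_predicative_recursive : predicative_recursive tR.
Proof.
split; first exact: tR_constructor.
exists tsafe, tprec; split.
- exact: tsafe_mapping.
- by split=> [f|g f h]; rewrite /tprec // => fg gh; apply: leq_trans gh fg.
- move=> f g /andP[fg gf]; congr (0 < _).
  by apply/eqP; rewrite eqn_leq; apply/andP; split.
- exact: tR_gt_pop.
Qed.

(** * A model of the rules *)

(* [Stuck] denotes calls that no rule covers. Constructors are interpreted
   freely, even on [Stuck], so that the rules that erase arguments remain valid
   equations. *)
Inductive dom : Type :=
| Stuck | DVar | DNil | DLet of letterM & dom | DConf of stateM & letterM & dom & dom.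

Definition dword (s : seq letterM) : dom := foldr DLet DNil s.

Fixpoint denc (d e : dom) : dom :=
  match d with
  | DNil => DLet (sep M) e
  | DLet a d' => if is_bit a then DLet a (denc d' e) else Stuck
  | _ => Stuck
  end.

Definition dinit (d : dom) : dom :=
  match d with
  | DNil => DConf (start M) (blank M) DNil DNil
  | DLet a d' => DConf (start M) a DNil d'
  | _ => Stuck
  end.

(** The outer [None] means that neither pattern for a half-tape applies, so that no rule for [Step]
    covers the call. *)
Definition dcell (d : dom) : option (option letterM * dom) :=
  match d with
  | DNil => Some (None, DNil)
  | DLet a d' => Some (Some a, d')
  | _ => None
  end.

Definition dstep (d : dom) : dom :=
  if d is DConf q a l r then
    if (dcell l, dcell r) is (Some (ol, l'), Some (or, r')) then
      match delta q a with
      | None => DConf q a l r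
      | Some (q', a', Stay) => DConf q' a' l r
      | Some (q', a', MoveLeft) => DConf q' (odflt (blank M) ol) l' (DLet a' r)
      | Some (q', a', MoveRight) => DConf q' (odflt (blank M) or) (DLet a' l) r'
      end
    else Stuck
  else Stuck.

(** The recursion is lexicographic in the level and [x]; the inner fixpoint descends along [x] at a
    fixed level. *)
Fixpoint diter (j : nat) (x y e : dom) : dom :=
  if j is j'.+1 then
    (fix loop x :=
       match x with
       | DNil => e
       | DLet _ x' => diter j' y y (loop x')
       | _ => Stuck
       end) x
  else dstep e.

Fixpoint dread (d : dom) : dom :=
  match d with
  | DNil => DNil
  | DLet a d' => if is_bit a then DLet a (dread d') else DNil
  | _ => Stuck
  end.

Definition dout (d : dom) : dom :=
  if d is DConf _ a _ r then dread (DLet a r) else Stuck.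

Definition dmain (ds : seq dom) : dom :=
  let clock := foldr denc (dword (nseq c (blank M))) ds in
  dout (diter m.+1 clock clock (dinit (foldr denc DNil ds))).

Definition dap (f : tsym) (ds : seq dom) : dom :=
  match f, ds with
  | Nil, [::] => DNil
  | Let a, [:: d] => DLet a d
  | Conf q a, [:: l; r] => DConf q a l r
  | Step, [:: d] => dstep d
  | Init, [:: d] => dinit d
  | Enc, [:: d; e] => denc d e
  | Iter j, [:: x; y; e] => diter j x y e
  | Read, [:: d] => dread d
  | Out, [:: d] => dout d
  | Main, _ => dmain ds
  | _, _ => Stuck
  end.

Fixpoint den (t : T) : dom :=
  match t with
  | Var _ => DVar
  | App f ts => dap f [seq den t | t <- ts]
  end.

Lemma den_word s : den (word s) = dword s.
Proof. by elim: s => //= a s ->. Qed.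

Lemma den_encs ts t : den (encs ts t) = foldr denc (den t) [seq den u | u <- ts].
Proof. by elim: ts => //= u ts ->. Qed.

Lemma subst_word sigma s : subst sigma (word s) = word s.
Proof. by elim: s => //= a s ->. Qed.

Lemma subst_encs sigma ts t :
  subst sigma (encs ts t) = encs [seq subst sigma u | u <- ts] (subst sigma t).
Proof. by elim: ts => //= u ts ->. Qed.

Lemma subst_main_rhs sigma ts :
  subst sigma (main_rhs ts) = main_rhs [seq subst sigma u | u <- ts].
Proof. by rewrite /main_rhs /= !subst_encs subst_word. Qed.

Lemma is_bit_bit b : is_bit (bit M b).
Proof. by rewrite /is_bit; case: b; rewrite eqxx ?orbT. Qed.

Lemma den_rule i sigma :
  den (subst sigma (rule_of i).1) = den (subst sigma (rule_of i).2).
Proof.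
case: i => [b|||a|q a ol or||j|j a|q a||a|] //=.
- by rewrite is_bit_bit.
- rewrite /step_rhs; case: ol => [b|]; case: or => [b'|] /=;
  by case: (delta q a) => [[[q' a'] []]|].
- by case: (is_bit a).
- by rewrite !subst_encs !den_encs subst_word den_word.
Qed.

Lemma den_ired s t : ired tR s t -> den s = den t.
Proof.
elim=> {s t} [s t|//|s t u _ -> _ ->//].
elim=> {s t} [l r sigma lr _|f us s t vs _ /= IH].
  by have [i Ei] := tRP lr; have := den_rule i sigma; rewrite -Ei.
by rewrite !map_cat /= IH.
Qed.

Fixpoint dclosed (d : dom) : bool :=
  match d with DNil => true | DLet _ d' => dclosed d' | _ => false end.

Fixpoint dbits (d : dom) : bool :=
  match d with DNil => true | DLet a d' => is_bit a && dbits d' | _ => false end.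

Lemma dclosed_denc d e : dclosed (denc d e) = dbits d && dclosed e.
Proof. by elim: d => //= a d IH; case: (is_bit a). Qed.

Lemma dclosed_dencs ds e : dclosed (foldr denc e ds) = all dbits ds && dclosed e.
Proof. by elim: ds => //= d ds IH; rewrite dclosed_denc IH andbA. Qed.

(** Level 0 passes [Stuck] to [dstep], and every higher level propagates it. *)
Lemma diter_stuck j x y : diter j x y Stuck = Stuck.
Proof. by elim: j x y => //= j IHj x y; elim: x => //= a x ->. Qed.

(** The innermost call gets stuck at the open end of [x], and strictness carries this outwards.
    Level 0 does not inspect [x], whence the successor. *)
Lemma diterS_open j x y e : ~~ dclosed x -> diter j.+1 x y e = Stuck.
Proof. by elim: x => //= a x IH /IH ->; rewrite diter_stuck. Qed.

Lemma dmain_stuck ds : ~~ all dbits ds -> dmain ds = Stuck.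
Proof.
by move=> nb; rewrite /dmain diterS_open // dclosed_dencs negb_and nb.
Qed.

Lemma value_not_stuck t : value t -> den t <> Stuck.
Proof.
case: t => // f ts /and3P[df sz _].
by case: f df sz => //= [|a|q a]; case: ts => //= ? [|? []].
Qed.

(** The model is faithful on words: constructors are free, and a variable denotes [DVar], which does
    not occur in [dword s]. *)
Lemma value_den_word t s : value t -> den t = dword s -> t = word s.
Proof.
elim: s t => [|a s IH] [//|f ts] /and3P[df sz vts].
  by case: f df sz => //= [|a|q a]; case: ts {vts} => //= ? [|? []].
case: f df sz => //= [|b|q b] _; case: ts vts => //= u [|? []] //=.
by rewrite andbT => vu _ [-> /(IH _ vu)->].
Qed.

Lemma dbitsP d : dbits d -> exists w, d = dword [seq bit M b | b <- w].
Proof.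
elim: d => //= [|a d IH]; first by exists [::].
case/andP=> ba /IH[w ->]; case/orP: ba => /eqP->.
  by exists (false :: w).
by exists (true :: w).
Qed.

(** * Simulation of the machine *)

Local Notation red := (ired tR).
(** An instance of a rule is given by the list of terms put for variables 0, 1, 2 and so on. *)
Local Notation red_rule i us :=
  (ired_rule tR_constructor (rule_of_in i) (sigma := nth (Var 0) us)).

Definition bitword (w : seq bool) : T := word [seq bit M b | b <- w].

Definition conf_term (cf : config M) : T :=
  ap (Conf (cstate cf) (chead cf)) [:: word (cleft cf); word (cright cf)].

Lemma value_word s : value (word s).
Proof. by elim: s => //= a s ->. Qed.

Lemma red_enc w s :
  red (ap Enc [:: bitword w; word s])
      (word (rcons [seq bit M b | b <- w] (sep M) ++ s)).
Proof.
elim: w => [|b w IH].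
  (* The entry [Var 0] only fills the slot of a variable absent from this rule. *)
  by apply: (red_rule EncNil [:: Var 0; word s]) => //=; rewrite value_word.
apply: (ired_trans (ap (Let (bit M b)) [:: ap Enc [:: bitword w; word s]])).
  by apply: (red_rule (EncBit b) [:: bitword w; word s]) => //=; rewrite !value_word.
by apply: ired_app (rt_refl _ _ _); constructor.
Qed.

Definition tape (ws : seq (seq bool)) : seq letterM :=
  flatten [seq rcons [seq bit M b | b <- w] (sep M) | w <- ws].

Lemma red_encs ws s :
  red (encs [seq bitword w | w <- ws] (word s)) (word (tape ws ++ s)).
Proof.
elim: ws => [|w ws IH]; first exact: rt_refl.
rewrite /tape /= -catA; apply: ired_app (red_enc _ _).
by do ?constructor => //; apply: rt_refl.
Qed.

Lemma red_init s :
  red (ap Init [:: word s])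
      (conf_term (Config (start M) [::] (head (blank M) s) (behead s))).
Proof.
case: s => [|a s].
  exact: (red_rule InitNil [::]).
by apply: (red_rule (InitLet a) [:: word s]) => //=; rewrite value_word.
Qed.

Lemma red_step cf : red (ap Step [:: conf_term cf]) (conf_term (tm_step cf)).
Proof.
case: cf => q l a r.
(* [ohead] turns an empty half-tape into [None] and so selects the matching pattern. *)
apply: (red_rule (StepConf q a (ohead l) (ohead r))
          [:: word (behead l); word (behead r)]); last by rewrite /= !value_word.
  by case: l => [|? l]; case: r => [|? r].
rewrite /= /step_rhs /tm_step /=.
by case: (delta q a) => [[[q' a'] []]|]; case: l => [|? l]; case: r => [|? r].
Qed.

(** At level [j.+1] each letter of [s] triggers one run of level [j] on two copies of [s'], which
    costs [size s' ^ j] machine steps. *)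
Lemma red_iter j (i : 'I_m.+2) s s' cf : i = j :> nat ->
  red (ap (Iter i) [:: word s; word s'; conf_term cf])
      (conf_term (iter (if j is j'.+1 then size s * size s' ^ j' else 1)
                    (@tm_step M) cf)).
Proof.
elim: j i s cf => [|j IHj] i s cf ij.
  have -> : i = ord0 by apply: val_inj.
  apply: (ired_trans (ap Step [:: conf_term cf])); last exact: red_step.
  apply: (red_rule Iter0 [:: word s; word s'; conf_term cf]) => //=.
  by rewrite !value_word.
have ltj : j < m.+1 by rewrite -ltnS -ij.
have -> : Iter i = iterS (Ordinal ltj) by congr Iter; apply: val_inj; rewrite /= ij.
elim: s => [|a s IHs] /=.
  apply: (red_rule (IterNil (Ordinal ltj)) [:: Var 0; word s'; conf_term cf]) => //=.
  by rewrite !value_word.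
apply: (ired_trans (ap (iterW (Ordinal ltj)) [:: word s'; word s';
  ap (iterS (Ordinal ltj)) [:: word s; word s'; conf_term cf]])).
  apply: (red_rule (IterLet (Ordinal ltj) a) [:: word s; word s'; conf_term cf]) => //=.
  by rewrite !value_word.
set cf' := iter _ _ _ in IHs.
(* The recursive call, evaluated first, leads to [cf']; the steps left over are exactly those of
   level [j] on [s'] and [s']. *)
have -> : iter ((size s).+1 * size s' ^ j) (@tm_step M) cf =
    iter (if j is j'.+1 then size s' * size s' ^ j' else 1) (@tm_step M) cf'.
  by rewrite -iterD mulSn; case: (j) => [|j'] //=; rewrite expnS.
apply: ired_app (IHj _ _ _ _) => //.
by do ?constructor => //; apply: rt_refl.
Qed.

Lemma red_read s : red (ap Read [:: word s]) (bitword (read_bits s)).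
Proof.
elim: s => [|a s IH].
  exact: (red_rule ReadNil [::]).
have go b : a = bit M b ->
    red (ap Read [:: word (a :: s)]) (bitword (b :: read_bits s)).
  move=> ->; apply: (ired_trans (ap (Let (bit M b)) [:: ap Read [:: word s]])).
    apply: (red_rule (ReadLet (bit M b)) [:: word s]) => //=.
      by rewrite is_bit_bit.
    by rewrite value_word.
  by apply: ired_app (rt_refl _ _ _); constructor.
rewrite [read_bits _]/=; case: eqP => [/go//|/eqP/negbTE nf].
case: eqP => [/go//|/eqP/negbTE nt].
apply: (red_rule (ReadLet a) [:: word s]) => //=; last by rewrite value_word.
by rewrite /is_bit nf nt.
Qed.

Lemma red_out cf : red (ap Out [:: conf_term cf]) (bitword (tm_output cf)).
Proof.
apply: (ired_trans (ap Read [:: word (chead cf :: cright cf)])); last exact: red_read.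
case: cf => q l a r; apply: (red_rule (OutConf q a) [:: word l; word r]) => //=.
by rewrite !value_word.
Qed.

Lemma red_main ws : size ws = k ->
  red (ap Main [seq bitword w | w <- ws])
      (bitword (tm_output
         (iter ((size (tape ws) + c) ^ m.+1) (@tm_step M) (tm_init M ws)))).
Proof.
move=> szw; set vs := map _ _.
have svs : [seq nth (Var 0) vs i | i <- iota 0 k] = vs.
  by rewrite map_nth_iota0 ?take_oversize // size_map szw.
apply: (ired_trans (main_rhs vs)).
  apply: (red_rule MainRule vs); rewrite ?subst_main_rhs /= -?map_comp ?svs //.
  by apply/allP=> _ /mapP[w _ ->]; apply: value_word.
apply: ired_app (red_out _); constructor; last by constructor.
(* With the clock in both normal positions, the top level runs its length to the power [m.+1]. *)
have := @red_iter m.+1 ord_max (tape ws ++ nseq c (blank M))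
  (tape ws ++ nseq c (blank M)) (tm_init M ws) erefl.
rewrite size_cat size_nseq -expnS; apply: ired_app.
do 2!apply: List.Forall2_cons (red_encs _ _) _.
apply: List.Forall2_cons (List.Forall2_nil _).
apply: ired_app (red_init _); apply: List.Forall2_cons (List.Forall2_nil _).
by have := red_encs ws [::]; rewrite cats0.
Qed.

Lemma numeral_bitword n :
  numeral (Nil : tsig) (Let (bit M false) : tsig) (Let (bit M true) : tsig) n =
  bitword (dyadic n).
Proof. by rewrite /numeral /bitword; elim: (dyadic n) => //= -[] w ->. Qed.

End Simulation.

(** * Time bounds and correctness of the simulation *)

Lemma poly_nat_bound (p : {poly nat}) :
  exists c d, forall n, (p.[n])%R <= (n + c) ^ d.+1.
Proof.
elim/poly_ind: p => [|p a [c [d IH]]]; first by exists 0, 0 => n; rewrite horner0.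
(* Horner's scheme: the new base [X] dominates [n + a], and the extra 1 makes it positive. *)
exists (c + a.+1), d.+1 => n; rewrite hornerMXaddC.
set X := n + (c + a.+1); have X0 : 0 < X by rewrite /X !addnS.
apply: (@leq_trans (X ^ d.+1 * n + X ^ d.+1 * a)).
  rewrite leq_add ?leq_pmull ?expn_gt0 ?X0 // leq_mul //.
  by apply: leq_trans (IH n) _; rewrite leq_exp2r // leq_add2l leq_addr.
by rewrite -mulnDr [X ^ d.+2]expnSr leq_mul // leq_add2l addnS leqW // leq_addl.
Qed.

Lemma tm_halted_iter (M : machine) (cf : config M) n n' :
  n <= n' -> tm_halted (iter n (@tm_step M) cf) ->
  iter n' (@tm_step M) cf = iter n (@tm_step M) cf.
Proof.
move=> /subnK <- h; rewrite iterD; set cf' := iter n _ _ in h *.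
elim: (n' - n) => //= i ->; rewrite /tm_step.
by move: h; rewrite /tm_halted; case: delta.
Qed.

Lemma size_tape (M : machine) ws : \sum_(w <- ws) size w <= size (tape M ws).
Proof.
elim: ws => [|w ws IH]; first by rewrite big_nil.
by rewrite big_cons /tape /= size_cat leq_add // size_rcons size_map.
Qed.

Theorem theorem7p4 (k : nat) (f : k.-tuple nat -> nat) (hf : polytime f) :
  exists (F : signature) (R : trs F),
    [/\ orthogonal R, predicative_recursive R & computes R f].
Proof.
have [M [p hM]] := hf.
have [c [m pm]] := poly_nat_bound p.
(* The bound [(n + c) ^ m.+1] on the running time fixes the padding [c] and the top level [m.+1]. *)
exists (tsig M k m), (tR M k m c); split.
- exact: tR_orthogonal.
- exact: tR_predicative_recursive.
exists (Nil M m), (Let m (bit M false)), (Let m (bit M true)), (Main M m).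
have nE := eq_map (@numeral_bitword M k m).
have redf (x : k.-tuple nat) :
    ired (tR M k m c) (App (Main M m : tsig M k m) [seq bitword M k m (dyadic n) | n <- x])
      (bitword M k m (dyadic (f x))).
  have [hx <-] := hM x.
  have := @red_main M k m c [seq dyadic n | n <- x].
  rewrite size_map size_tuple -map_comp => /(_ erefl).
  (* The clock outlasts the time bound, since the tape is at least as long as the input; the surplus
     steps leave the halted configuration fixed. *)
  rewrite (tm_halted_iter _ hx) //; apply: leq_trans (pm _) _.
  rewrite leq_exp2r // leq_add2r; apply: leq_trans (size_tape _ _).
  by rewrite big_map.
split=> //.
  by split=> //=; apply/eqP=> -[] /bit_inj.
move=> vs w; split=> [[szv vvs vw [rw _]]|[x [-> ->]]]; last first.
  rewrite nE numeral_bitword; split.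
  - by rewrite size_map size_tuple.
  - by apply/allP=> _ /mapP[n _ ->]; apply: value_word.
  - exact: value_word.
  - by split; [apply: redf | apply/(value_nf (@tR_constructor M k m c))/value_word].
(* Otherwise the call denotes [Stuck], whereas its result is a value. *)
have bvs : all (@dbits M) [seq den c t | t <- vs].
  apply: contraT => /(dmain_stuck m c) stuck.
  by case: (value_not_stuck (c := c) vw); rewrite -(den_ired rw).
have [x vsE] : exists x : seq nat, vs = [seq bitword M k m (dyadic n) | n <- x].
  elim: vs vvs bvs {szv rw} => [|v vs IH] /=; first by exists [::].
  case/andP=> vv /IH{}IH /andP[/dbitsP[u vE] /IH[x ->]].
  exists (dyadic_val u :: x); rewrite /= dyadic_valK; congr cons.
  exact: value_den_word vE.
have szx : size x == k by rewrite -[k]szv vsE size_map.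
exists (Tuple szx); rewrite nE numeral_bitword; split=> //.
(* Both [w] and the computed numeral are reducts of the same call, so they share its denotation,
   which determines the word. *)
apply: (value_den_word (c := c) vw).
by rewrite -(den_ired rw) vsE (den_ired (redf (Tuple szx))) den_word.
Qed.
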